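(* Let $E$ be a Banach lattice satisfying Assumption (A) (stated in the context), let $G$ be a group and let $\rho \colon G \to \mathrm{ZAut}^+_s(E)\cdot \mathrm{IAut}^+_s(E)$ be a positive representation with compact image. Then there exist a unique positive representation $\pi \colon G \to \mathrm{IAut}^+_s(E)$ and an $m \in \mathrm{ZAut}^+(E)$ such that \[ \rho_s = m \pi_s m^{-1} \quad \text{for all } s \in G. \] The image of $\pi$ is compact. Conversely, any positive representation $\pi \colon G \to \mathrm{IAut}^+_s(E)$ with compact image and any $m \in \mathrm{ZAut}^+(E)$ define a positive representation $\rho$ with compact image in $\mathrm{ZAut}^+_s(E)\cdot \mathrm{IAut}^+_s(E)$ by $\rho_s := m \pi_s m^{-1}$ for all $s \in G$. In this correspondence between $\rho$ and $\pi$ (when $G$ is a topological group), $\rho$ is strongly continuous if and only if $\pi$ is strongly continuous.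
   Context: Banach lattices are real. $\mathrm{Aut}^+(E)$ is the group of lattice automorphisms of $E$ (these are automatically bounded), and $\mathrm{IAut}^+(E)$ is the subgroup of isometric lattice automorphisms. The center $Z(E)$ is the set of regular operators $m$ on $E$ with $-\lambda I \le m \le \lambda I$ for some $\lambda \ge 0$, and $\mathrm{ZAut}^+(E) := \mathrm{Aut}^+(E)\cap Z(E)$ is the group of central lattice automorphisms. The subscript $s$ on these sets indicates that they are equipped with the strong operator topology; compactness of images is with respect to this topology. A positive representation of a group $G$ in $E$ is a group homomorphism $\rho\colon G \to \mathrm{Aut}^+(E)$, and $\rho_s$ denotes $\rho(s)$ for $s \in G$; it is strongly continuous if it is continuous for the strong operator topology. The set $\mathrm{ZAut}^+(E)\cdot \mathrm{IAut}^+(E) = \{m\phi : m \in \mathrm{ZAut}^+(E), \phi \in \mathrm{IAut}^+(E)\}$ is a subgroup of $\mathrm{Aut}^+(E)$, the factorization $m\phi$ of each of its elements is unique, and $p(m\phi) := \phi$ defines a group homomorphism $p$ from it onto $\mathrm{IAut}^+(E)$. Assumption (A) on $E$: for every compact subgroup $G \subset \mathrm{ZAut}^+_s(E)\cdot \mathrm{IAut}^+_s(E)$, the restriction $p|_G \colon G \to \mathrm{IAut}^+_s(E)$ is continuous. *)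

(* Defs.v *)
From HB Require Import structures.
From mathcomp Require Import all_boot all_order all_algebra.
From mathcomp Require Import all_classical all_reals all_analysis.

Set Implicit Arguments.
Unset Strict Implicit.
Unset Printing Implicit Defensive.

Import Order.TTheory GRing.Theory Num.Theory.
Import numFieldNormedType.Exports.

Local Open Scope classical_set_scope.
Local Open Scope ring_scope.

(* The order is not inherited from Order.Lattice: Num.RealDomain already joins
   lattices and additive groups, so Hierarchy Builder rejects any further
   structure above both that is not above Num.RealDomain.
   `|x| is the norm of x; the modulus of x is vjoin x (- x). *)
HB.mixin Record isBanachLattice (R : realType) E
    of CompleteNormedModule R E := {
  vle : rel E;
  vmeet : E -> E -> E;
  vjoin : E -> E -> E;
  vlexx : reflexive vle;
  vle_anti : antisymmetric vle;
  vle_trans : transitive vle;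
  vlexI : forall x y z, vle x (vmeet y z) = vle x y && vle x z;
  vleUx : forall x y z, vle (vjoin x y) z = vle x z && vle y z;
  vleD2r : forall z x y, vle x y -> vle (x + z) (y + z);
  vleZ2l : forall (a : R) x y, 0 <= a -> vle x y -> vle (a *: x) (a *: y);
  vle_norm : forall x y, vle (vjoin x (- x)) (vjoin y (- y)) -> `|x| <= `|y|;
}.

#[short(type="banachLatticeType")]
HB.structure Definition BanachLattice (R : realType) :=
  {E of CompleteNormedModule R E & isBanachLattice R E}.

HB.mixin Record isTopologicalGroup G of Group G & Topological G := {
  mulg_continuous : continuous (fun x : G * G => (x.1 * x.2)%g);
  invg_continuous : continuous (fun x : G => x^-1%g);
}.

#[short(type="topologicalGroupType")]
HB.structure Definition TopologicalGroup :=
  {G of Group G & Topological G & isTopologicalGroup G}.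

Section Operators.
Context {R : realType} {E : banachLatticeType R}.

Definition positive_op (T : E -> E) := forall x, vle 0 x -> vle 0 (T x).

Definition op_le (S T : E -> E) := positive_op (T \- S).

Definition regular_op (T : E -> E) :=
  exists P Q : {linear E -> E},
    [/\ positive_op P, positive_op Q & T = P \- Q].

Definition center : set (E -> E) :=
  [set m | regular_op m /\
    exists2 l : R, 0 <= l &
      op_le (fun x => - (l *: x)) m /\ op_le m (fun x => l *: x)].

End Operators.

Record latticeAut (R : realType) (E : banachLatticeType R) := LatticeAut {
  laut_fun :> E -> E;
  laut_inv : E -> E;
  laut_linear : linear laut_fun;
  laut_meet : {morph laut_fun : x y / vmeet x y};
  laut_join : {morph laut_fun : x y / vjoin x y};
  laut_funK : cancel laut_fun laut_inv;
  laut_invK : cancel laut_inv laut_fun }.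

Section LatticeAutGroup.
Context {R : realType} {E : banachLatticeType R}.
Implicit Types S T U : latticeAut E.

Lemma laut_eqP S T : laut_fun S =1 laut_fun T -> S = T.
Proof.
case: S => f f' fl fm fj fK f'K; case: T => g g' gl gm gj gK g'K /= /funext eqfg.
subst g; have eqfg' : f' = g'.
  by apply/funext => x; apply: (can_inj fK); rewrite f'K g'K.
by subst g'; congr LatticeAut; exact: Prop_irrelevance.
Qed.

Definition laut_one : latticeAut E.
Proof. by exists idfun idfun. Defined.

Definition laut_mul S T : latticeAut E.
Proof.
exists (S \o T) (laut_inv T \o laut_inv S).
- by move=> a x y /=; rewrite !laut_linear.
- by move=> x y /=; rewrite !laut_meet.
- by move=> x y /=; rewrite !laut_join.
- by apply: can_comp; exact: laut_funK.
- by apply: can_comp; exact: laut_invK.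
Defined.

Definition laut_opp T : latticeAut E.
Proof.
exists (laut_inv T) T.
- by move=> a x y; apply: (can_inj (laut_funK T)); rewrite laut_linear !laut_invK.
- by move=> x y; apply: (can_inj (laut_funK T)); rewrite laut_meet !laut_invK.
- by move=> x y; apply: (can_inj (laut_funK T)); rewrite laut_join !laut_invK.
- exact: laut_invK.
- exact: laut_funK.
Defined.

HB.instance Definition _ := gen_eqMixin (latticeAut E).
HB.instance Definition _ := gen_choiceMixin (latticeAut E).

Lemma laut_mulA : associative laut_mul.
Proof. by move=> S T U; exact: laut_eqP. Qed.

Lemma laut_mul1 : left_id laut_one laut_mul.
Proof. by move=> T; exact: laut_eqP. Qed.

Lemma laut_1mul : right_id laut_one laut_mul.
Proof. by move=> T; exact: laut_eqP. Qed.

Lemma laut_mulV : left_inverse laut_one laut_opp laut_mul.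
Proof. by move=> T; apply: laut_eqP => x; exact: laut_funK. Qed.

Lemma laut_Vmul : right_inverse laut_one laut_opp laut_mul.
Proof. by move=> T; apply: laut_eqP => x; exact: laut_invK. Qed.

HB.instance Definition _ := isGroup.Build (latticeAut E)
  laut_mulA laut_mul1 laut_1mul laut_mulV laut_Vmul.

(* The strong operator topology is the topology of pointwise convergence on E,
   where E carries its norm topology. *)
HB.instance Definition _ := Topological.copy (latticeAut E)
  (initial_topology (@laut_fun R E : latticeAut E -> {ptws E -> E})).

End LatticeAutGroup.

Section Subgroups.
Context {R : realType} (E : banachLatticeType R).

Definition IAut : set (latticeAut E) :=
  [set phi | forall x, `|phi x| = `|x|].

Definition ZAut : set (latticeAut E) :=
  [set m | center (m : E -> E)].

Definition ZIAut : set (latticeAut E) :=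
  [set (m * phi)%g | m in ZAut & phi in IAut].

(* The isometric factor of an element of ZIAut (the factorization is unique);
   the value outside ZIAut is arbitrary. *)
Definition isom_part (T : latticeAut E) : latticeAut E :=
  xget 1%g [set phi | IAut phi /\ exists2 m, ZAut m & T = (m * phi)%g].

Definition assumptionA : Prop :=
  forall K : set (latticeAut E), group_closed [in K] -> compact K -> K `<=` ZIAut ->
    {within K, continuous isom_part}.

End Subgroups.

Arguments IAut {R} E _.
Arguments ZAut {R} E _.
Arguments ZIAut {R} E _.

Definition positive_rep {R : realType} {E : banachLatticeType R}
    {G : groupType} (rho : G -> latticeAut E) : Prop :=
  {morph rho : s t / (s * t)%g}.

Definition positive_rep_in {R : realType} {E : banachLatticeType R}
    {G : groupType} (H : set (latticeAut E)) (rho : G -> latticeAut E) : Prop :=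
  positive_rep rho /\ range rho `<=` H.

(* Main.v *)
(* Write rho_s = m_s phi_s with m_s central and phi_s isometric. The cocycle
   identity m_(st) = m_s phi_s m_t phi_s^-1 shows that the average m of the m_t
   satisfies rho_s m = m phi_s, which is the assertion once m is known to be
   invertible in the center.

   No Haar measure is needed. By compactness of rho(G) and Assumption (A), each
   orbit map t |-> m_t x is totally bounded under translations. As in von
   Neumann's construction of means, finite averages of its right translates have
   arbitrarily small oscillation, and so do averages of its left translates;
   since the two kinds of averages commute, they determine a unique constant,
   which is m x. Uniqueness gives linearity and equivariance.

   The m_t and their inverses are uniformly bounded in norm by Banach-Steinhaus.
   For central operators norm bounds imply order bounds, because T(Tx)^+ >= 0 for
   x >= 0 when T is central. So b x <= m_t x <= c x with 0 < b <= c, these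
   inequalities pass to m, and m is onto by Banach's fixed point theorem. *)
Require Import Defs.
From HB Require Import structures.
From mathcomp Require Import all_boot all_order all_algebra.
From mathcomp Require Import all_classical all_reals all_analysis.
From mathcomp Require Import ring lra.

Set Implicit Arguments.
Unset Strict Implicit.
Unset Printing Implicit Defensive.

Import Order.TTheory GRing.Theory Num.Theory.
Import numFieldNormedType.Exports.

Local Open Scope classical_set_scope.

#[local] Arguments vleD2r {R s} z [x y].
#[local] Arguments vleZ2l {R s} [a x y].
#[local] Arguments vle_norm {R s} [x y].

Local Notation "x <=| y" := (vle x y) (at level 70).

(** * Vector lattices *)

Section VectorLattice.
Local Open Scope ring_scope.
Context {R : realType} {E : banachLatticeType R}.
Implicit Types (x y z t : E) (a b c : R).

Lemma vletr x y z : x <=| y -> y <=| z -> x <=| z.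
Proof. exact: vle_trans. Qed.

Lemma vleU1 x y : x <=| vjoin x y.
Proof. by have := vlexx (vjoin x y); rewrite vleUx => /andP[]. Qed.

Lemma vleU2 x y : y <=| vjoin x y.
Proof. by have := vlexx (vjoin x y); rewrite vleUx => /andP[]. Qed.

Lemma vleI1 x y : vmeet x y <=| x.
Proof. by have := vlexx (vmeet x y); rewrite vlexI => /andP[]. Qed.

Lemma vleI2 x y : vmeet x y <=| y.
Proof. by have := vlexx (vmeet x y); rewrite vlexI => /andP[]. Qed.

Lemma vle_asym x y : x <=| y -> y <=| x -> x = y.
Proof. by move=> xy yx; apply: vle_anti; rewrite xy yx. Qed.

Lemma vleD x y z t : x <=| y -> z <=| t -> x + z <=| y + t.
Proof.
move=> xy zt; apply: vletr (vleD2r z xy) _.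
by rewrite [y + z]addrC [y + t]addrC; exact: vleD2r.
Qed.

Lemma subv_ge0 x y : (0 <=| y - x) = (x <=| y).
Proof.
apply/idP/idP => h.
  by have := vleD2r x h; rewrite add0r subrK.
by have := vleD2r (- x) h; rewrite subrr.
Qed.

Lemma vleN2 x y : (- x <=| - y) = (y <=| x).
Proof. by rewrite -subv_ge0 opprK addrC subv_ge0. Qed.

Lemma oppv_le0 x : (- x <=| 0) = (0 <=| x).
Proof. by rewrite -{1}oppr0 vleN2. Qed.

Lemma vaddr_ge0 x y : 0 <=| x -> 0 <=| y -> 0 <=| x + y.
Proof. by move=> x0 y0; have := vleD x0 y0; rewrite addr0. Qed.

Lemma vlerDl x y : 0 <=| y -> x <=| x + y.
Proof. by move=> y0; have := vleD (vlexx x) y0; rewrite addr0. Qed.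

Lemma vscale_ge0 a x : 0 <= a -> 0 <=| x -> 0 <=| a *: x.
Proof. by move=> a0 x0; have := vleZ2l a0 x0; rewrite scaler0. Qed.

Lemma vleZ2r a b x : a <= b -> 0 <=| x -> a *: x <=| b *: x.
Proof.
by move=> ab x0; rewrite -subv_ge0 -scalerBl vscale_ge0 ?subr_ge0.
Qed.

Lemma vjoinC x y : vjoin x y = vjoin y x.
Proof. by apply: vle_asym; rewrite vleUx vleU1 vleU2. Qed.

Lemma vmeetC x y : vmeet x y = vmeet y x.
Proof. by apply: vle_asym; rewrite vlexI vleI1 vleI2. Qed.

Lemma vjoinDr x y z : vjoin (x + z) (y + z) = vjoin x y + z.
Proof.
apply: vle_asym; first by rewrite vleUx !vleD2r ?vleU1 ?vleU2.
rewrite -[vjoin (x + z) _](subrK z); apply: vleD2r.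
rewrite vleUx -[X in X <=| _](addrK z) vleD2r ?vleU1 //=.
by rewrite -[X in X <=| _](addrK z) vleD2r ?vleU2.
Qed.

Lemma vmeetE x y : vmeet x y = - vjoin (- x) (- y).
Proof.
apply: vle_asym.
  by rewrite -vleN2 opprK vleUx !vleN2 vleI1 vleI2.
by rewrite vlexI -vleN2 opprK vleU1 -vleN2 opprK vleU2.
Qed.

Lemma vmeetDr x y z : vmeet (x + z) (y + z) = vmeet x y + z.
Proof. by rewrite !vmeetE !opprD vjoinDr opprD opprK. Qed.

Lemma vjoin_meet x y : vjoin x y + vmeet x y = x + y.
Proof.
have -> : vjoin x y = vjoin (- y) (- x) + (x + y).
  by rewrite -vjoinDr addKr [- y + _]addrC addrK.
by rewrite vmeetE (vjoinC (- x)) addrAC subrr add0r.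
Qed.

Lemma vmeet_mono x y z t : x <=| y -> z <=| t -> vmeet x z <=| vmeet y t.
Proof.
move=> xy zt; rewrite vlexI (vletr (vleI1 _ _) xy).
exact: vletr (vleI2 _ _) zt.
Qed.

Lemma vjoinZ a x y : 0 < a -> vjoin (a *: x) (a *: y) = a *: vjoin x y.
Proof.
move=> a0; have a_neq0 : a != 0 by rewrite gt_eqF.
apply: vle_asym; first by rewrite vleUx !vleZ2l ?vleU1 ?vleU2 ?ltW.
rewrite -[vjoin (a *: x) _]scale1r -(mulfV a_neq0) -scalerA.
apply: vleZ2l; first exact: ltW.
rewrite vleUx -[X in X <=| _]scale1r -[X in _ && (X <=| _)]scale1r.
by rewrite -(mulVf a_neq0) -!scalerA !vleZ2l ?invr_ge0 ?vleU1 ?vleU2 ?ltW.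
Qed.

Lemma vmeetZ a x y : 0 < a -> vmeet (a *: x) (a *: y) = a *: vmeet x y.
Proof. by move=> a0; rewrite !vmeetE -2!scalerN vjoinZ // scalerN. Qed.

Definition vpos x := vjoin x 0.
Definition vabs x := vjoin x (- x).

Lemma vpos_ge0 x : 0 <=| vpos x. Proof. exact: vleU2. Qed.

Lemma vle_pos x : x <=| vpos x. Proof. exact: vleU1. Qed.

Lemma vpos_le x y : x <=| y -> 0 <=| y -> vpos x <=| y.
Proof. by move=> xy y0; rewrite vleUx xy y0. Qed.

Lemma vpos_id x : 0 <=| x -> vpos x = x.
Proof. by move=> x0; apply: vle_asym _ (vle_pos _); rewrite vpos_le ?vlexx. Qed.

Lemma vposB x : vpos x - vpos (- x) = x.
Proof.
suff -> : vpos x = vpos (- x) + x by rewrite addrC addKr.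
by rewrite /vpos -vjoinDr addNr add0r vjoinC.
Qed.

Lemma vpos_disj x : vmeet (vpos x) (vpos (- x)) = 0.
Proof.
rewrite -{1}[vpos x](subrK (vpos (- x))) vposB -{2}[vpos (- x)]add0r vmeetDr.
by rewrite vmeetE oppr0 addNr.
Qed.

Lemma vpos_eq0 x : vpos (- x) = 0 -> 0 <=| x.
Proof. by move=> x0; have := vle_pos (- x); rewrite x0 oppv_le0. Qed.

Lemma vpos_meet x y : vpos (x - y) = x - vmeet x y.
Proof.
by rewrite vmeetE opprK [x + vjoin _ _]addrC -vjoinDr addNr /vpos vjoinC [- y + x]addrC.
Qed.

Lemma vabsE x : vabs x = vpos x + vpos (- x).
Proof.
have -> : vabs x = vpos (2 *: x) - x.
  by rewrite /vpos /vabs -vjoinDr add0r scaler_nat mulr2n addrK.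
rewrite /vpos -[X in vjoin _ X](scaler0 E 2) vjoinZ // scaler_nat mulr2n.
by rewrite -/(vpos x) -{3}[x]vposB opprB addrC subrKA addrC.
Qed.

Lemma vabs_ge0 x : 0 <=| vabs x.
Proof. by rewrite vabsE vaddr_ge0 ?vpos_ge0. Qed.

Lemma vle_abs x : x <=| vabs x. Proof. exact: vleU1. Qed.

Lemma vleN_abs x : - x <=| vabs x. Proof. exact: vleU2. Qed.

Lemma vabsN x : vabs (- x) = vabs x.
Proof. by rewrite /vabs opprK vjoinC. Qed.

Lemma vabs_le x y : x <=| y -> - x <=| y -> vabs x <=| y.
Proof. by move=> xy Nxy; rewrite vleUx xy Nxy. Qed.

Lemma vabs_id x : 0 <=| x -> vabs x = x.
Proof.
move=> x0; apply: vle_asym _ (vle_abs _); apply: vabs_le (vlexx _) _.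
by apply: (vletr _ x0); rewrite oppv_le0.
Qed.

Lemma vabsD x y : vabs (x + y) <=| vabs x + vabs y.
Proof. by apply: vabs_le; rewrite ?opprD vleD ?vle_abs ?vleN_abs. Qed.

Lemma vpos_le_abs x : vpos x <=| vabs x.
Proof. by rewrite vpos_le ?vle_abs ?vabs_ge0. Qed.

Lemma vpos_leD x y : vpos x <=| vpos y + vabs (x - y).
Proof.
apply: vpos_le; last by rewrite vaddr_ge0 ?vpos_ge0 ?vabs_ge0.
by rewrite -{1}[x](subrK y) addrC vleD ?vle_pos ?vle_abs.
Qed.

Lemma vabs_posB x y : vabs (vpos x - vpos y) <=| vabs (x - y).
Proof.
have le_sub z t : vpos z - vpos t <=| vabs (z - t).
  by rewrite -subv_ge0 opprB addrA subv_ge0 addrC vpos_leD.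
apply: vabs_le; first exact: le_sub.
by rewrite opprB -[x - y]opprB vabsN; exact: le_sub.
Qed.

Lemma vabs_norm x : `|vabs x| = `|x|.
Proof.
have e : vjoin (vabs x) (- vabs x) = vjoin x (- x).
  by rewrite -!/(vabs _) vabs_id ?vabs_ge0.
by apply: le_anti; rewrite !vle_norm // e vlexx.
Qed.

Lemma vle_normP x y : vabs x <=| y -> `|x| <= `|y|.
Proof.
move=> xy; apply: vle_norm; apply: vletr xy _; exact: vle_abs.
Qed.

Lemma vle_norm_ge0 x y : 0 <=| x -> x <=| y -> `|x| <= `|y|.
Proof. by move=> x0 xy; apply: vle_normP; rewrite vabs_id. Qed.

(** Since [(-y)^+ = 0], the element [(-x)^+] lies below [|x - y|], so its norm is at most every
    [e]. *)
Lemma vge0_closed x :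
  (forall e, 0 < e -> exists2 y, 0 <=| y & `|x - y| <= e) -> 0 <=| x.
Proof.
move=> h; apply: vpos_eq0; apply/eqP; rewrite -normr_le0.
apply/ler_addgt0Pl => e /h[y y0 xy]; rewrite addr0; apply: le_trans xy.
have Ny0 : vpos (- y) = 0.
  by apply: vle_asym _ (vpos_ge0 _); rewrite vpos_le ?vlexx // oppv_le0.
have := vpos_leD (- x) (- y); rewrite Ny0 add0r -opprD vabsN => le_abs.
by rewrite -[leRHS]vabs_norm vle_norm_ge0 ?vpos_ge0.
Qed.

(** With [d] the left side, [d - x /\ z] is the join of [d - x] and [d - z]; the first is negative
    and the second lies below both [x] and [y]. *)
Lemma vmeet_leD x y z : 0 <=| x -> 0 <=| y -> 0 <=| z ->
  vmeet x (y + z) <=| vmeet x y + vmeet x z.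
Proof.
move=> x0 y0 z0; set d := vmeet x (y + z).
have dx : d <=| x := vleI1 _ _; have dyz : d <=| y + z := vleI2 _ _.
rewrite -[d](subrK (vmeet x z)); apply: vleD2r.
rewrite [X in d - X]vmeetE opprK addrC.
rewrite -vjoinDr vleUx !vlexI.
have dx0 : - x + d <=| 0 by rewrite -subv_ge0 sub0r opprD opprK subv_ge0.
rewrite (vletr dx0 x0) (vletr dx0 y0) /=; apply/andP; split.
  rewrite -[x]add0r; apply: vleD dx; by rewrite oppv_le0.
by rewrite -subv_ge0 opprD opprK addrA subv_ge0.
Qed.

(** The equation forces both elements to be positive, so no modulus appears. *)
Definition vdisj x y := vmeet x y = 0.

Lemma vdisjC x y : vdisj x y -> vdisj y x.
Proof. by rewrite /vdisj vmeetC. Qed.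

Lemma vdisj_le x y z t : 0 <=| x -> 0 <=| z -> x <=| y -> z <=| t ->
  vdisj y t -> vdisj x z.
Proof.
move=> x0 z0 xy zt yt; apply: vle_asym; last by rewrite vlexI x0 z0.
by rewrite -yt; exact: vmeet_mono.
Qed.

Lemma vdisjxx x : 0 <=| x -> vdisj x x -> x = 0.
Proof. by move=> x0 <-; apply: vle_asym _ (vleI1 _ _); rewrite vlexI !vlexx. Qed.

Lemma vdisjZ a b x y : 0 <= a -> 0 <= b -> 0 <=| x -> 0 <=| y ->
  vdisj x y -> vdisj (a *: x) (b *: y).
Proof.
(* A common factor above [a] and [b]; the [1] makes it strictly positive, as [vmeetZ] demands. *)
move=> a0 b0 x0 y0 xy; pose c := a + b + 1.
have c0 : 0 < c by rewrite ltr_wpDl ?addr_ge0.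
apply: (@vdisj_le _ (c *: x) _ (c *: y)); rewrite ?vscale_ge0 //.
- by apply: vleZ2r => //; rewrite /c -addrA lerDl addr_ge0.
- by apply: vleZ2r => //; rewrite /c addrAC lerDr addr_ge0.
- by rewrite /vdisj vmeetZ // xy scaler0.
Qed.

End VectorLattice.

(** * Central operators *)

Section CentralOperators.
Local Open Scope ring_scope.
Context {R : realType} {E : banachLatticeType R}.
Implicit Types (x y z : E).

(** This is [-mu I <= T <= mu I], stated for operators that may change sign, such as [m - c I]. *)
Definition order_bounded_by (mu : R) (T : E -> E) :=
  forall z, 0 <=| z -> vabs (T z) <=| mu *: z.

(* [p] is a component of [w], so that pointwise [p] is [0] or [w]; a jump of at
   most [b] from [0] is then only possible where [w <= b]. *)
Lemma vdisj_step (b p p' w : E) :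
  0 <=| p -> 0 <=| w -> p <=| b -> vdisj p (vabs (w - p)) ->
  p' <=| p + b -> p' <=| w -> p' <=| b.
Proof.
move=> p0 w0 pb dpq p'p p'w; set q := w - p in dpq.
(* The negative part of [q] lies below both [p] and [|q|], which are disjoint. *)
have q0 : 0 <=| q.
  apply: vpos_eq0; apply: vdisjxx (vpos_ge0 _) _.
  apply: vdisj_le dpq; rewrite ?vpos_ge0 //.
    by apply: vpos_le => //; rewrite /q opprB -subv_ge0 opprB addrC subrK.
  by rewrite -vabsN vpos_le_abs.
rewrite vabs_id // in dpq.
(* As [q /\ b] is disjoint from [p], their sum is their join, which [b] dominates. *)
have : p' <=| vmeet q b + p.
  rewrite -vmeetDr vlexI; apply/andP; split; last by rewrite addrC.
  by rewrite /q subrK.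
move=> /vletr; apply; rewrite -vjoin_meet.
have -> : vmeet (vmeet q b) p = 0.
  have qb0 : 0 <=| vmeet q b by rewrite vlexI q0 (vletr p0).
  apply: vdisjC; apply: vdisj_le dpq => //; [exact: vlexx | exact: vleI1].
by rewrite addr0 vleUx vleI2 pb.
Qed.

Variables (mu : R) (T : {linear E -> E}).
Hypotheses (mu0 : 0 <= mu) (Tmu : order_bounded_by mu T).

Lemma order_bounded_vdisj x y : 0 <=| x -> 0 <=| y -> vdisj x y ->
  vdisj (vabs (T x)) (vabs (T y)).
Proof.
move=> x0 y0 xy; apply: (@vdisj_le _ _ _ (mu *: x) _ (mu *: y)) (Tmu x0) (Tmu y0) _.
- exact: vabs_ge0.
- exact: vabs_ge0.
- exact: vdisjZ.
Qed.

Lemma order_bounded_norm x : `|T x| <= mu * `|x|.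
Proof.
rewrite -[X in _ <= _ * X]vabs_norm -[X in X * _](ger0_norm mu0) -normrZ.
apply: vle_normP; rewrite [vabs x]vabsE scalerDr -{1}[x]vposB linearB /=.
apply: vletr (vabsD _ _) _; rewrite vabsN.
by apply: vleD; apply: Tmu; exact: vpos_ge0.
Qed.

Section Slices.
Variables (x : E).
Hypothesis x0 : 0 <=| x.
Let u := vpos (T x).
Let v := vpos (- T x).
Let slice (c : R) := vmeet u (c *: x).
Let p (c : R) := vpos (- T (slice c)).
Let w := vpos (- T u).

Let u0 : 0 <=| u. Proof. exact: vpos_ge0. Qed.
Let v0 : 0 <=| v. Proof. exact: vpos_ge0. Qed.

Let slice_ge0 c : 0 <= c -> 0 <=| slice c.
Proof. by move=> c0; rewrite vlexI u0 vscale_ge0. Qed.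

(** Let [f] be the slice, [r = (u - c x)^+] and [s = (c x - u)^+]. From [u = r + f], [|w - p c|]
    lies below [|T r|]; from [c x = s + f], [p c] lies below [|T s|]; and [T] preserves the
    disjointness of [r] and [s]. *)
Let slice_component c : 0 <= c -> vdisj (p c) (vabs (w - p c)).
Proof.
move=> c0; have f0 := slice_ge0 c0; set f := slice c in f0 *.
pose r := vpos (u - c *: x); pose s := vpos (c *: x - u).
have uE : u = r + f by rewrite /r vpos_meet subrK.
have cxE : c *: x = s + f by rewrite /s vpos_meet vmeetC subrK.
have rs : vdisj r s by rewrite /s -opprB; exact: vpos_disj.
have TrTs := order_bounded_vdisj (vpos_ge0 _) (vpos_ge0 _) rs.
have wp : vabs (w - p c) <=| vabs (T r).
  apply: vletr (vabs_posB _ _) _; rewrite -opprD vabsN -linearB /=.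
  by rewrite {1}uE addrK vlexx.
have pf : p c <=| mu *: u.
  apply: vletr (vpos_le_abs _) _; rewrite vabsN; apply: vletr (Tmu f0) _.
  by apply: vleZ2l => //; exact: vleI1.
have p_cv_Ts : p c <=| c *: v + vabs (T s).
  apply: vpos_le; last by rewrite vaddr_ge0 ?vscale_ge0 ?vabs_ge0.
  have -> : T f = c *: T x - T s by rewrite -linearZ /= cxE linearD addrAC subrr add0r.
  rewrite opprB addrC; apply: vleD (vle_abs _).
  by rewrite -scalerN; apply: vleZ2l => //; exact: vle_pos.
(* [p c] lies below a multiple of [u], which is disjoint from [v], so the term [c v] contributes
   nothing. *)
have pTs : p c <=| vabs (T s).
  have : p c <=| vmeet (p c) (c *: v + vabs (T s)) by rewrite vlexI vlexx.
  move=> /vletr; apply; apply: vletr (vmeet_leD _ _ _) _.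
  - exact: vpos_ge0.
  - exact: vscale_ge0.
  - exact: vabs_ge0.
  have -> : vmeet (p c) (c *: v) = 0.
    apply: (@vdisj_le _ _ _ (mu *: u) _ (c *: v)) pf (vlexx _) _.
    - exact: vpos_ge0.
    - exact: vscale_ge0.
    - apply: vdisjZ => //; exact: vpos_disj.
  by rewrite add0r vleI2.
apply: vdisjC; apply: (vdisj_le _ _ wp pTs TrTs); [exact: vabs_ge0|exact: vpos_ge0].
Qed.

(** The slice grows by an element between [0] and [e x], whose image has modulus at most
    [mu e x]. *)
Let slice_step c e : 0 <= c -> 0 <= e -> p (c + e) <=| p c + (mu * e) *: x.
Proof.
move=> c0 e0; apply: vletr (vpos_leD _ (- T (slice c))) _.
rewrite [X in _ <=| X]addrC [X in X <=| _]addrC; apply: vleD2r.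
rewrite -opprD vabsN -linearB /=.
have fd : slice (c + e) - slice c <=| e *: x.
  rewrite -[e *: x](addKr (slice c)) [X in X <=| _]addrC.
  apply: (vleD (vlexx _)); rewrite /slice scalerDl.
  apply: vletr (vmeet_leD u0 _ _) _; rewrite ?vscale_ge0 //.
  by apply: vleD (vlexx _) _; exact: vleI2.
have fd0 : 0 <=| slice (c + e) - slice c.
  rewrite subv_ge0 /slice; apply: vmeet_mono; first exact: vlexx.
  by rewrite vleZ2r // lerDl.
apply: vletr (Tmu fd0) _.
by rewrite -scalerA; apply: vleZ2l.
Qed.

(* With [u = (Tx)^+] and [w = (Tu)^-], the negative part of [T (u /\ c x)] is a
   component of [w] for every [c]; it is [0] for [c = 0], it is [w] for [c = mu],
   and it grows by at most [mu e x] when [c] grows by [e]. Hence [w <= mu e x]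
   for arbitrarily small [e]. *)
Lemma order_bounded_pos : 0 <=| T (vpos (T x)).
Proof.
apply: vpos_eq0; rewrite -/u -/w; apply/eqP; rewrite -normr_le0.
have w_le n : w <=| (mu * (mu / n.+1%:R)) *: x.
  (* After [n + 1] steps of size [e] the slice is all of [u], because [u <= |T x| <= mu x]. *)
  pose e := mu / n.+1%:R; have e0 : 0 <= e by rewrite divr_ge0.
  have b0 : 0 <=| (mu * e) *: x by rewrite vscale_ge0 ?mulr_ge0.
  have wE : p (e *+ n.+1) = w.
    rewrite /p /slice -mulr_natr divfK ?pnatr_eq0 //.
    congr (vpos (- T _)); apply: vle_asym (vleI1 _ _) _.
    by rewrite vlexI vlexx (vletr (vpos_le_abs _)) ?Tmu.
  have pw k : p (e *+ k) <=| w.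
    have := slice_component (mulrn_wge0 k e0); set q := p _ => d.
    (* This positive part lies below the disjoint elements [q] and [|w - q|]. *)
    have wq : vpos (q - w) = 0.
      apply: vdisjxx (vpos_ge0 _) _; apply: vdisj_le d; rewrite ?vpos_ge0 //.
        apply: vpos_le; last exact: vpos_ge0.
        by rewrite -subv_ge0 opprB addrC subrK vpos_ge0.
      by rewrite -[w - q]opprB vabsN vpos_le_abs.
    by rewrite -subv_ge0; apply: vpos_eq0; rewrite opprB.
  suff : p (e *+ n.+1) <=| (mu * e) *: x by rewrite wE.
  elim: n.+1 => [|k IH].
    rewrite mulr0n /p /slice scale0r.
    have -> : vmeet u 0 = 0 by apply: vle_asym (vleI2 _ _) _; rewrite vlexI u0 vlexx.
    by rewrite linear0 oppr0 vpos_id ?vlexx.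
  apply: (vdisj_step _ _ IH (slice_component (mulrn_wge0 k e0))) (pw _).
  - exact: vpos_ge0.
  - exact: vpos_ge0.
  - by rewrite mulrSr slice_step ?mulrn_wge0.
apply/ler_addgt0Pl => e e0; rewrite addr0.
have [n n_gt] : exists n : nat, (mu * mu * `|x| / e) < n.+1%:R.
  exists (Num.truncn (mu * mu * `|x| / e)); exact: truncnS_gt.
apply: le_trans (vle_norm_ge0 (vpos_ge0 _) (w_le n)) _.
rewrite normrZ ger0_norm ?mulr_ge0 ?divr_ge0 //.
rewrite !mulrA mulrAC ler_pdivrMr ?ltr0n // [e * _]mulrC.
by move: n_gt; rewrite ltr_pdivrMr // => /ltW.
Qed.

End Slices.
End CentralOperators.

(** * Central and isometric lattice automorphisms *)

Section LatticeAutomorphisms.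
Local Open Scope ring_scope.
Context {R : realType} {E : banachLatticeType R}.
Implicit Types (x y z : E) (S T m phi psi : latticeAut E).

HB.instance Definition _ T :=
  GRing.isLinear.Build R E E *:%R (laut_fun T) (laut_linear T).

Lemma lautM S T x : (S * T)%g x = S (T x). Proof. by []. Qed.

Lemma lautVK T : cancel (T^-1)%g T. Proof. exact: laut_invK. Qed.

Lemma lautKV T : cancel T (T^-1)%g. Proof. exact: laut_funK. Qed.

Lemma laut_ge0 T x : 0 <=| x -> 0 <=| T x.
Proof.
by move=> x0; rewrite -(vpos_id x0) /vpos laut_join linear0 vleU2.
Qed.

Lemma laut_le T x y : x <=| y -> T x <=| T y.
Proof. by rewrite -subv_ge0 => /(laut_ge0 T); rewrite linearB subv_ge0. Qed.

Lemma laut_abs T x : vabs (T x) = T (vabs x).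
Proof. by rewrite /vabs laut_join linearN. Qed.

(** Positivity of [m] yields regularity, as [m - 0], and the lower bound, so centrality becomes one
    inequality on the positive cone. *)
Lemma ZAutP m :
  ZAut E m <-> exists2 l, 0 <= l & forall x, 0 <=| x -> m x <=| l *: x.
Proof.
split=> [[_ [l l0 [_ ml]]]|[l l0 ml]].
  by exists l => // x x0; have := ml x x0; rewrite /= subv_ge0.
split.
  exists (m : {linear E -> E}), (\0 : {linear E -> E}); split => //.
  - exact: laut_ge0.
  - by move=> x _; rewrite /= vlexx.
  - by apply/funext => x /=; rewrite subr0.
exists l => //; split=> x x0 /=.
  by rewrite opprK vaddr_ge0 ?laut_ge0 ?vscale_ge0.
by rewrite subv_ge0; exact: ml.
Qed.

Lemma ZAut_order_bounded m : ZAut E m ->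
  exists2 l, 0 <= l & order_bounded_by l m.
Proof.
move=> /ZAutP[l l0 ml]; exists l => // x x0.
by rewrite vabs_id ?laut_ge0 // ml.
Qed.

(** For [T = m - B' I] and [y = (T x)^+], [order_bounded_pos] gives [B' y <= m y]. In norm,
    [B' |y| <= B |y|], which forces [y = 0]. *)
Lemma central_le m (B B' : R) : ZAut E m -> 0 <= B -> B < B' ->
  (forall x, `|m x| <= B * `|x|) -> forall x, 0 <=| x -> m x <=| B' *: x.
Proof.
move=> /ZAut_order_bounded[l l0 ml] B0 BB' mB x x0.
have B'0 : 0 <= B' by rewrite (le_trans B0) ?ltW.
pose T : {linear E -> E} := m \- (B' \*: idfun).
have T_bd : order_bounded_by (l + B') T.
  move=> z z0; apply: vletr (vabsD _ _) _; rewrite scalerDl vabsN.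
  by apply: vleD; [exact: ml | rewrite /= vabs_id ?vlexx ?vscale_ge0].
have /= := order_bounded_pos (addr_ge0 l0 B'0) T_bd x0.
set y := vpos _; rewrite subv_ge0 => By.
have y0 : 0 <=| y by exact: vpos_ge0.
have yE : y = 0.
  apply/eqP; rewrite -normr_le0 -(pmulr_rle0 _ (_ : 0 < B' - B)) ?subr_gt0 //.
  rewrite mulrBl subr_le0; apply: le_trans (mB y).
  rewrite -[X in X * _]ger0_norm // -normrZ.
  by apply: vle_norm_ge0 => //; rewrite vscale_ge0.
by rewrite -subv_ge0; apply: vpos_eq0; rewrite opprB.
Qed.

(** The dual argument with [T = b I - m]: now [m y <= b y], so [|y| <= C |m y| <= C b |y|] and
    [y = 0]. *)
Lemma central_ge m (C b : R) : ZAut E m -> 0 <= C -> 0 <= b -> C * b < 1 ->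
  (forall x, `|x| <= C * `|m x|) -> forall x, 0 <=| x -> b *: x <=| m x.
Proof.
move=> /ZAut_order_bounded[l l0 ml] C0 b0 Cb mC x x0.
pose T : {linear E -> E} := (b \*: idfun) \- m.
have T_bd : order_bounded_by (b + l) T.
  move=> z z0; apply: vletr (vabsD _ _) _; rewrite scalerDl vabsN.
  by apply: vleD; [rewrite /= vabs_id ?vlexx ?vscale_ge0 | exact: ml].
have /= := order_bounded_pos (addr_ge0 b0 l0) T_bd x0.
set y := vpos _; rewrite subv_ge0 => my.
have y0 : 0 <=| y by exact: vpos_ge0.
have yE : y = 0.
  apply/eqP; rewrite -normr_le0 -(pmulr_rle0 _ (_ : 0 < 1 - C * b)) ?subr_gt0 //.
  rewrite mulrBl mul1r subr_le0; apply: le_trans (mC y) _.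
  rewrite -mulrA ler_wpM2l // -[X in X * _]ger0_norm // -normrZ.
  by apply: vle_norm_ge0 => //; exact: laut_ge0.
by rewrite -subv_ge0; apply: vpos_eq0; rewrite opprB.
Qed.

Lemma vle_cvg (u : nat -> E) (l y : E) :
  u @ \oo --> l -> (\forall n \near \oo, y <=| u n) -> y <=| l.
Proof.
move=> ul yu; rewrite -subv_ge0; apply: vge0_closed => e e0.
have /cvgrPdist_le/(_ e e0) ule := ul.
near \oo => n; exists (u n - y); first by rewrite subv_ge0; near: n.
by rewrite opprB addrA subrK; near: n.
Unshelve. all: by end_near. Qed.

(** Automatic continuity of positive operators: otherwise there are positive [y_n] of norm [2^-n]
    with [|T y_n| >= 2^n], and their sum [s] dominates each of them, so [|T s| >= 2^n] for all
    [n]. *)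
Lemma laut_bounded T : exists2 C, 0 < C & forall x, `|T x| <= C * `|x|.
Proof.
apply: contrapT => noC.
have big (n : nat) : exists y : E,
    [/\ 0 <=| y, `|y| = 2 ^- n & 2 ^+ n <= `|T y|].
  apply: contrapT => noy; apply: noC; exists (2 ^+ n * 2 ^+ n) => [|x].
    by rewrite mulr_gt0 ?exprn_gt0.
  rewrite leNgt; apply/negP => Tx.
  have x0 : `|vabs x| != 0.
    rewrite vabs_norm normr_eq0; apply/eqP => x0.
    by move: Tx; rewrite x0 linear0 !normr0 mulr0 ltxx.
  apply: noy; exists ((2 ^- n / `|vabs x|) *: vabs x); split.
  - by rewrite vscale_ge0 ?vabs_ge0 // divr_ge0 ?invr_ge0 ?exprn_ge0.
  - by rewrite normrZ ger0_norm ?divfK // divr_ge0 ?invr_ge0 ?exprn_ge0.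
  rewrite linearZ /= normrZ ger0_norm; last first.
    by rewrite divr_ge0 ?invr_ge0 ?exprn_ge0.
  rewrite -laut_abs !vabs_norm mulrAC ler_pdivlMr; last first.
    by rewrite lt_def normr_ge0 andbT -vabs_norm.
  by rewrite -ler_pdivrMl ?invr_gt0 ?exprn_gt0 // invrK mulrA ltW.
have [y yP] := choice big.
have y_cvg : cvgn (series y).
  apply: normed_cvg.
  have -> : [normed series y] = series (geometric 1 (2^-1 : R)).
    apply/funext => n; rewrite /series /=; apply: eq_bigr => k _.
    by have [_ -> _] := yP k; rewrite mul1r exprVn.
  by apply: is_cvg_geometric_series; rewrite ger0_norm ?invf_lt1 ?ltr1n.
pose s := limn (series y).
have ys n : y n <=| s.
  apply: (vle_cvg y_cvg); near=> N.
  have nN : (n < N)%N by near: N; exists n.+1.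
  rewrite /series /= (bigD1_seq n) /= ?mem_index_iota ?iota_uniq ?leq0n //.
  rewrite vlerDl //; apply: (big_ind (fun z => 0 <=| z)).
  - exact: vlexx.
  - by move=> a b; exact: vaddr_ge0.
  - by move=> i _; have [] := yP i.
have Ts n : 2 ^+ n <= `|T s|.
  have [yn0 _ /le_trans] := yP n; apply.
  by apply: vle_norm_ge0; [exact: laut_ge0 | exact: laut_le].
have : `|T s| < `|T s|.
  apply: lt_le_trans (Ts (Num.truncn `|T s|).+1).
  by apply: lt_le_trans (truncnS_gt _) _; rewrite -natrX ler_nat ltnW // ltn_expl.
by rewrite ltxx.
Unshelve. all: by end_near. Qed.

Lemma ZAutM m n : ZAut E m -> ZAut E n -> ZAut E (m * n)%g.
Proof.
move=> /ZAutP[l l0 ml] /ZAutP[k k0 nk]; apply/ZAutP.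
exists (l * k) => [|x x0]; first exact: mulr_ge0.
rewrite lautM -scalerA; apply: vletr (ml _ (laut_ge0 _ x0)) _.
by rewrite vleZ2l ?nk.
Qed.

(** Boundedness of the inverse gives [b I <= m] through [central_ge], and applying this at [m^-1 x]
    gives [m^-1 <= b^-1 I]. *)
Lemma ZAutV m : ZAut E m -> ZAut E m^-1%g.
Proof.
move=> mZ; have [C C0 VC] := laut_bounded (m^-1)%g.
(* Chosen so that [C b = 1/2]. *)
pose b := (2 * C)^-1; have b0 : 0 < b by rewrite invr_gt0 mulr_gt0.
have Cb : C * b < 1.
  by rewrite /b invfM mulrCA mulfV ?gt_eqF // mulr1 invf_lt1 ?ltr1n.
have mC x : `|x| <= C * `|m x| by rewrite -{1}(lautKV m x) VC.
have mb := central_ge mZ (ltW C0) (ltW b0) Cb mC.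
apply/ZAutP; exists b^-1 => [|x x0]; first by rewrite invr_ge0 ltW.
have := mb _ (laut_ge0 (m^-1)%g x0); rewrite lautVK => h.
have := vleZ2l (_ : 0 <= b^-1) h; rewrite scalerA mulVf ?gt_eqF // scale1r.
by apply; rewrite invr_ge0 ltW.
Qed.

Lemma ZAutJ m T : ZAut E m -> ZAut E (T * m * T^-1)%g.
Proof.
move=> /ZAutP[l l0 ml]; apply/ZAutP; exists l => // x x0.
rewrite -{2}[x](lautVK T) -linearZ !lautM /=; apply: laut_le.
exact: ml (laut_ge0 (T^-1)%g x0).
Qed.

Lemma IAutV phi : IAut E phi -> IAut E phi^-1%g.
Proof. by move=> h x; rewrite -[in RHS](lautVK phi x) h. Qed.

Lemma IAutM phi psi : IAut E phi -> IAut E psi -> IAut E (phi * psi)%g.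
Proof. by move=> h h' x; rewrite lautM h h'. Qed.

(** For an isometry, [central_le] applies with every constant above [1] and [central_ge] with every
    constant below [1]; closedness of the cone then gives [m x = x] for positive [x]. *)
Lemma ZAut_IAut_trivial m : ZAut E m -> IAut E m -> m = 1%g.
Proof.
move=> mZ mI.
have le1 x : 0 <=| x -> m x = x.
  move=> x0; apply: vle_asym; rewrite -subv_ge0; apply: vge0_closed => e e0.
    pose d := e / (`|x| + 1); have d0 : 0 < d by rewrite divr_gt0 ?ltr_wpDl.
    exists ((1 + d) *: x - m x).
      rewrite subv_ge0; apply: (central_le mZ ler01) x0; first by rewrite ltrDl.
      by move=> z; rewrite mI mul1r.
    rewrite opprB addrA subrK scalerDl scale1r opprD addrA subrr sub0r normrN.
    rewrite normrZ gtr0_norm // /d mulrAC ler_pdivrMr ?ltr_wpDl //.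
    by rewrite ler_pM2l // lerDl.
  have c0 : 0 < `|x| + 1 + e by rewrite addr_gt0 // ltr_wpDl.
  (* The summand [e] in the denominator ensures [d < 1], so that [1 - d] is an admissible lower
     constant. *)
  pose d := e / (`|x| + 1 + e); have d0 : 0 < d by rewrite divr_gt0.
  have d1 : d < 1 by rewrite ltr_pdivrMr // mul1r ltrDr ltr_wpDl.
  exists (m x - (1 - d) *: x).
    rewrite subv_ge0; apply: (central_ge mZ ler01) x0.
    - by rewrite subr_ge0 ltW.
    - by rewrite mul1r gtrBl.
    - by move=> z; rewrite mI mul1r.
  rewrite opprB [_ - x + _]addrC addrA subrK scalerBl scale1r addrAC subrr add0r normrN.
  rewrite normrZ gtr0_norm // /d mulrAC ler_pdivrMr //.
  by rewrite ler_pM2l // -addrA lerDl addr_ge0 ?ltW.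
apply: laut_eqP => x.
by rewrite -[x]vposB linearB /= !le1 ?vpos_ge0.
Qed.

(** [n^-1 m = psi phi^-1] is both central and isometric. *)
Lemma ZIAut_factor_unique m n phi psi : ZAut E m -> ZAut E n ->
  IAut E phi -> IAut E psi -> (m * phi)%g = (n * psi)%g -> phi = psi.
Proof.
move=> mZ nZ phiI psiI e.
have : (n^-1 * m)%g = 1%g.
  apply: ZAut_IAut_trivial; first by apply: ZAutM => //; exact: ZAutV.
  suff -> : (n^-1 * m)%g = (psi * phi^-1)%g by apply: IAutM => //; exact: IAutV.
  by rewrite -[m](mulgK phi) e !mulgA mulVg mul1g.
move=> /(congr1 (fun k : latticeAut E => n * k)%g).
rewrite mulgA mulgV mul1g mulg1 => mn.
by move: e; rewrite mn => /mulgI.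
Qed.

Lemma isom_partE m phi : ZAut E m -> IAut E phi -> isom_part (m * phi)%g = phi.
Proof.
move=> mZ phiI; rewrite /isom_part; case: xgetP => [psi _ [psiI [n nZ e]]|].
  exact/esym/(ZIAut_factor_unique mZ nZ phiI psiI e).
by move=> /(_ phi) []; split=> //; exists m.
Qed.

(** [m pi m^-1 = m (pi m^-1 pi^-1) pi], where the conjugate in brackets is again central. *)
Lemma conj_ZIAut m pi : ZAut E m -> IAut E pi ->
  ZIAut E (m * pi * m^-1)%g /\ isom_part (m * pi * m^-1)%g = pi.
Proof.
move=> mZ piI.
have kZ : ZAut E (m * (pi * m^-1 * pi^-1))%g.
  by apply: ZAutM => //; apply: ZAutJ; exact: ZAutV.
have e : (m * pi * m^-1 = m * (pi * m^-1 * pi^-1) * pi)%g.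
  by rewrite -!mulgA mulVg mulg1.
split; rewrite e; last exact: isom_partE.
by exists (m * (pi * m^-1 * pi^-1))%g => //; exists pi.
Qed.

End LatticeAutomorphisms.

(** * Invariant means on groups *)

Section InvariantMean.
Local Open Scope ring_scope.
Context {R : realType} {E : completeNormedModType R} {G : groupType}.
Implicit Types (F H : G -> E) (us vs : seq G) (c d : E).

Definition avgr us F (s : G) : E := (size us)%:R^-1 *: \sum_(u <- us) F (s * u)%g.

Definition avgl us F (s : G) : E := (size us)%:R^-1 *: \sum_(u <- us) F (u * s)%g.

Definition osc_le F (D : R) := forall s t, `|F s - F t| <= D.

(* The translation is inserted between [s] and [t], so that a net for [F] serves
   all left and right averages of [F] as well. *)
Definition translation_net F (eta : R) us :=
  forall u, exists2 u', u' \in us &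
    forall s t, `|F (s * u * t)%g - F (s * u' * t)%g| <= eta.

Definition translation_tb F :=
  forall eta, 0 < eta -> exists us, translation_net F eta us.

Definition rmean F c := forall e, 0 < e ->
  exists us, (0 < size us)%N /\ forall s, `|avgr us F s - c| <= e.

Definition lmean F c := forall e, 0 < e ->
  exists us, (0 < size us)%N /\ forall s, `|avgl us F s - c| <= e.

Lemma avg_dist us (f g : G -> E) (e : R) : (0 < size us)%N ->
  (forall u, `|f u - g u| <= e) ->
  `|(size us)%:R^-1 *: \sum_(u <- us) f u - (size us)%:R^-1 *: \sum_(u <- us) g u| <= e.
Proof.
move=> us0 fg; rewrite -scalerBr -sumrB normrZ ger0_norm ?invr_ge0 //.
rewrite ler_pdivrMl ?ltr0n //; apply: le_trans (ler_norm_sum _ _ _) _.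
apply: le_trans (ler_sum _ (fun u _ => fg u)) _.
by rewrite big_const_seq count_predT iter_addr_0 mulr_natl.
Qed.

Lemma avg_cst us c : (0 < size us)%N ->
  (size us)%:R^-1 *: \sum_(u <- us) c = c.
Proof.
move=> us0; rewrite big_const_seq count_predT iter_addr_0 -[c *+ _]scaler_nat scalerA.
by rewrite mulVf ?scale1r // pnatr_eq0 -lt0n.
Qed.

Lemma avgr_near us F c (e : R) : (0 < size us)%N ->
  (forall s, `|F s - c| <= e) -> forall s, `|avgr us F s - c| <= e.
Proof.
move=> us0 Fc s; rewrite -{1}(avg_cst c us0).
exact: (avg_dist (f := fun u => F (s * u)%g) (g := fun=> c)).
Qed.

Lemma avgl_near us F c (e : R) : (0 < size us)%N ->
  (forall s, `|F s - c| <= e) -> forall s, `|avgl us F s - c| <= e.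
Proof.
move=> us0 Fc s; rewrite -{1}(avg_cst c us0).
exact: (avg_dist (f := fun u => F (u * s)%g) (g := fun=> c)).
Qed.

Lemma avglr us vs F : avgl us (avgr vs F) = avgr vs (avgl us F).
Proof.
apply/funext => s; rewrite /avgl /avgr -!scaler_sumr !scalerA mulrC.
congr (_ *: _); rewrite exchange_big; apply: eq_bigr => v _.
by apply: eq_bigr => u _; rewrite mulgA.
Qed.

Lemma avgrr us vs F :
  avgr us (avgr vs F) = avgr [seq (u * v)%g | u <- us, v <- vs] F.
Proof.
apply/funext => s; rewrite /avgr size_allpairs natrM invfM -scaler_sumr scalerA.
congr (_ *: _); rewrite big_allpairs_dep; apply: eq_bigr => u _.
by apply: eq_bigr => v _; rewrite mulgA.
Qed.

Lemma translation_net_avgr us vs F (eta : R) : (0 < size vs)%N ->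
  translation_net F eta us -> translation_net (avgr vs F) eta us.
Proof.
move=> vs0 net u; have [u' u'us uu'] := net u; exists u' => // s t.
apply: avg_dist vs0 _ => v; rewrite -![(_ * t * v)%g]mulgA; exact: uu'.
Qed.

Lemma translation_net_size us F (eta : R) : translation_net F eta us -> (0 < size us)%N.
Proof. by move=> /(_ 1%g)[u]; case: us. Qed.

Lemma translation_tb_avgr vs F : (0 < size vs)%N ->
  translation_tb F -> translation_tb (avgr vs F).
Proof.
move=> vs0 tb eta /tb[us net]; exists us; exact: translation_net_avgr.
Qed.

Lemma sum_osc us vs F (D : R) (s t : G) : osc_le F D -> size us = size vs ->
  `|\sum_(u <- us) F (s * u)%g - \sum_(v <- vs) F (t * v)%g| <= D *+ size us.
Proof.
move=> FD; elim: us vs => [|u us IH] [|v vs] //= => [_|[uv]].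
  by rewrite !big_nil subrr normr0.
rewrite !big_cons opprD addrACA mulrS (le_trans (ler_normD _ _)) // lerD //.
exact: IH.
Qed.

(* The first term of the average at [t] is paired with a term of the average at
   [s] that is [eta]-close to it; the remaining pairs contribute at most [D]. *)
Lemma osc_avgr us F (eta D : R) : translation_net F eta us -> osc_le F D ->
  osc_le (avgr us F) ((D *+ (size us).-1 + eta) / (size us)%:R).
Proof.
move=> net FD s t; have us0 := translation_net_size net.
rewrite /avgr -scalerBr normrZ ger0_norm ?invr_ge0 // mulrC ler_pM2r; last first.
  by rewrite invr_gt0 ltr0n.
case: us us0 net => // u us _ net.
(* As [u'] approximates [s^-1 t u], the value at [s u'] is close to the value at [t u]. *)
have [u' u'us uu'] := net (s^-1 * t * u)%g.
have -> : \sum_(v <- u :: us) F (s * v)%g =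
    F (s * u')%g + \sum_(v <- rem u' (u :: us)) F (s * v)%g.
  by rewrite (big_rem u' u'us).
rewrite big_cons opprD addrACA addrC.
apply: le_trans (ler_normD _ _) _; apply: lerD.
  by rewrite -(size_rem u'us); apply: sum_osc => //; rewrite size_rem.
by have := uu' s 1%g; rewrite !mulg1 !mulgA mulgV mul1g distrC.
Qed.

Lemma translation_tb_osc F : translation_tb F -> exists2 D, 0 <= D & osc_le F D.
Proof.
move=> /(_ 1 ltr01)[us net]; pose M := 1 + \sum_(u <- us) `|F u|.
have FM s : `|F s| <= M.
  have [u uus /(_ 1%g 1%g)] := net s; rewrite !mul1g !mulg1 => Fsu.
  rewrite -[F s](subrK (F u)) (le_trans (ler_normD _ _)) // lerD //.
  by rewrite (big_rem u uus) /= lerDl sumr_ge0.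
exists (M + M) => [|s t]; first by rewrite addr_ge0 // (le_trans _ (FM 1%g)).
by rewrite (le_trans (ler_normB _ _)) // lerD.
Qed.

(** One averaging over a net of [n] elements turns an oscillation bound [eta + D] into [eta + q D]
    with [q = (n - 1) / n < 1]. *)
Lemma small_osc F : translation_tb F -> forall e, 0 < e ->
  exists us, (0 < size us)%N /\ osc_le (avgr us F) e.
Proof.
move=> tb e e0; have [D D0 FD] := translation_tb_osc tb.
have [eta eta0 ->] : exists2 eta, 0 < eta & e = eta + eta.
  by exists (e / 2); [rewrite divr_gt0 | rewrite -splitr].
have [us net] := tb _ eta0; have us0 := translation_net_size net.
pose n := size us; pose q : R := (n.-1)%:R / n%:R.
have q0 : 0 <= q by rewrite divr_ge0.
have q1 : q < 1 by rewrite ltr_pdivrMr ?ltr0n // mul1r ltr_nat prednK.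
(* The same net serves in every round, since right averages inherit it from [F]. *)
have iter_osc k : exists vs, (0 < size vs)%N /\ osc_le (avgr vs F) (eta + q ^+ k * D).
  elim: k => [|k [vs [vs0 vsD]]].
    exists [:: 1%g]; split=> // s t.
    rewrite /avgr !big_seq1 !mulg1 invr1 !scale1r expr0 mul1r.
    by apply: le_trans (FD s t) _; rewrite lerDr ltW.
  exists [seq (u * v)%g | u <- us, v <- vs]; rewrite -avgrr size_allpairs muln_gt0.
  split=> [|s t]; first by rewrite us0.
  apply: le_trans (osc_avgr (translation_net_avgr vs0 net) vsD s t) _.
  have nV : n%:R^-1 = 1 - q.
    have n0 : n%:R != 0 :> R by rewrite pnatr_eq0 -lt0n.
    have -> : q = (n%:R - 1) / n%:R by rewrite /q -(natrB _ us0) subn1.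
    by field.
  rewrite -/n -[_ *+ n.-1]mulr_natr [(_ + eta) / _]mulrDl -mulrA -/q nV exprS.
  by rewrite le_eqVlt; apply/orP; left; apply/eqP; ring.
have [k qk] : exists k, q ^+ k * D <= eta.
  have : (fun k => q ^+ k * D) @ \oo --> 0 * D.
    by apply: cvgMl; apply: cvg_expr; rewrite ger0_norm.
  rewrite mul0r => /cvgrPdist_le/(_ _ eta0)[k _ /(_ k (leqnn k))].
  by rewrite /= sub0r normrN => /(le_trans (ler_norm _)); exists k.
have [vs [vs0 vsD]] := iter_osc k; exists vs; split=> // s t.
by apply: le_trans (vsD s t) _; rewrite lerD2l.
Qed.

End InvariantMean.

(** * Existence, uniqueness and linearity of the mean *)

Section InvariantMeanExistence.
Local Open Scope ring_scope.
Context {R : realType} {E : completeNormedModType R} {G : groupType}.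
Implicit Types (F H : G -> E) (us vs : seq G) (c d : E).

(** The substitution of [s^-1] for [s] exchanges left and right averages. *)
Lemma small_oscl F : translation_tb F -> forall e, 0 < e ->
  exists us, (0 < size us)%N /\ osc_le (avgl us F) e.
Proof.
move=> tb e e0; pose F' s := F s^-1%g.
have tb' : translation_tb F'.
  move=> eta /tb[us net]; exists [seq u^-1%g | u <- us] => u.
  have [u' u'us uu'] := net u^-1%g; exists u'^-1%g; first exact: map_f.
  by move=> s t; rewrite /F' !invgM invgK !mulgA; exact: uu'.
have [us [us0 osc]] := small_osc tb' e0.
exists [seq u^-1%g | u <- us]; rewrite size_map; split=> // s t.
have avgE x : avgl [seq u^-1%g | u <- us] F x = avgr us F' x^-1%g.
  rewrite /avgl /avgr size_map big_map; congr (_ *: _).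
  by apply: eq_bigr => u _; rewrite /F' invgM invgK.
by rewrite !avgE.
Qed.

(* Left and right averages commute, so approximate right and left means of the
   same function are close to each other. *)
Lemma mean_near us ws F c d (e e' : R) : (0 < size us)%N -> (0 < size ws)%N ->
  (forall s, `|avgr us F s - c| <= e) -> (forall s, `|avgl ws F s - d| <= e') ->
  `|c - d| <= e + e'.
Proof.
move=> us0 ws0 Fc Fd.
have := avgl_near ws0 Fc 1%g; rewrite avglr distrC => c1.
have d1 := avgr_near us0 Fd 1%g.
rewrite -[c - d](subrKA (avgr us (avgl ws F) 1%g)).
by rewrite (le_trans (ler_normD _ _)) // lerD.
Qed.

Lemma mean_unique F c d : rmean F c -> lmean F d -> c = d.
Proof.
move=> Fc Fd; apply/eqP; rewrite -subr_eq0 -normr_le0.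
apply/ler_addgt0Pl => e e0; rewrite addr0 [e]splitr.
have e20 : 0 < e / 2 by rewrite divr_gt0.
have [us [us0 usc]] := Fc _ e20; have [ws [ws0 wsd]] := Fd _ e20.
exact: mean_near usc wsd.
Qed.

(** Right averages almost equal to [c k] and left averages almost equal to [d l] satisfy [mean_near]
    for all [k] and [l], so [c] is Cauchy and [d] has the same limit. *)
Lemma mean_exists F : translation_tb F -> exists2 c, rmean F c & lmean F c.
Proof.
move=> tb; have n0 (n : nat) : 0 < (n.+1%:R)^-1 :> R by rewrite invr_gt0.
have [us usP] := choice (fun n => small_osc tb (n0 n)).
have [ws wsP] := choice (fun n => small_oscl tb (n0 n)).
pose c n := avgr (us n) F 1%g; pose d n := avgl (ws n) F 1%g.
have usc n s : `|avgr (us n) F s - c n| <= n.+1%:R^-1 by have [_] := usP n; apply.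
have wsd n s : `|avgl (ws n) F s - d n| <= n.+1%:R^-1 by have [_] := wsP n; apply.
have cd k l : `|c k - d l| <= k.+1%:R^-1 + l.+1%:R^-1.
  by apply: mean_near (usc k) (wsd l); [have [] := usP k | have [] := wsP l].
have small e : 0 < e -> \forall n \near \oo, (n.+1%:R)^-1 < e :> R.
  by move=> e0; exact: (near_infty_natSinv_lt (PosNum e0)).
have c_cvg : cvgn c.
  apply/cauchy_cvgP/cauchy_exP => e e0.
  have e20 : 0 < e / 2 by rewrite divr_gt0.
  have [l _ /(_ l (leqnn l)) le2] := small _ e20; exists (d l).
  suff : \forall k \near \oo, ball (d l) e (c k) by [].
  near=> k; rewrite -ball_normE /ball_ /= distrC; apply: le_lt_trans (cd _ _) _.
  rewrite [e]splitr.
  by rewrite ltrD //; near: k; exact: small.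
exists (limn c) => e e0.
- have e20 : 0 < e / 2 by rewrite divr_gt0.
  have /cvgrPdist_le/(_ _ e20) ce := c_cvg.
  have [n ne nc] : exists2 n, n.+1%:R^-1 <= e / 2 & `|limn c - c n| <= e / 2.
    near \oo => n; exists n; last by near: n.
    by rewrite ltW //; near: n; exact: small.
  exists (us n); split=> [|s]; first by have [] := usP n.
  rewrite -(subrKA (c n)) [e]splitr (le_trans (ler_normD _ _)) // lerD //.
    exact: le_trans (usc n s) ne.
  by rewrite distrC.
(* Quarters, because the distance from [d n] to [c n] takes two of the four shares. *)
- have e30 : 0 < e / 4 by rewrite divr_gt0.
  have /cvgrPdist_le/(_ _ e30) ce := c_cvg.
  have [n ne nc] : exists2 n, n.+1%:R^-1 <= e / 4 & `|limn c - c n| <= e / 4.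
    near \oo => n; exists n; last by near: n.
    by rewrite ltW //; near: n; exact: small.
  exists (ws n); split=> [|s]; first by have [] := wsP n.
  have h1 := wsd n s; have h2 := cd n n.
  have -> : avgl (ws n) F s - limn c =
      avgl (ws n) F s - d n + (d n - c n + (c n - limn c)).
    by rewrite !subrKA.
  rewrite distrC in nc; rewrite distrC in h2.
  apply: le_trans (ler_normD _ _) _.
  apply: le_trans (lerD h1 (le_trans (ler_normD _ _) (lerD h2 nc))) _.
  by move: (n.+1%:R^-1) ne => r re; lra.
Unshelve. all: by end_near. Qed.

(** Average first for [F], then for the averaged [H]. The second averaging keeps [F] near [c], and
    the first keeps the mean of [H], since it commutes with left averages. *)
Lemma rmean_linear F H (a : R) c d : translation_tb H ->
  rmean F c -> rmean H d -> lmean H d ->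
  rmean (fun t => a *: F t + H t) (a *: c + d).
Proof.
move=> tbH Fc Hd Hd' e e0.
pose e' := e / (`|a| + 1); have a0 : 0 < `|a| + 1 by rewrite ltr_wpDl.
have e'0 : 0 < e' by rewrite divr_gt0.
have [us [us0 usc]] := Fc _ e'0.
have [d' H'd' _] := mean_exists (translation_tb_avgr us0 tbH).
have dd' : d' = d.
  apply: mean_unique H'd' _ => eps /Hd'[ws [ws0 wsd]]; exists ws; split=> // s.
  by rewrite avglr; exact: avgr_near.
rewrite {}dd' in H'd'; have [vs [vs0 vsd]] := H'd' _ e'0.
exists [seq (v * u)%g | v <- vs, u <- us]; rewrite size_allpairs muln_gt0 us0 vs0.
split=> // s; rewrite -avgrr.
have -> : avgr vs (avgr us (fun t => a *: F t + H t)) s =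
    a *: avgr vs (avgr us F) s + avgr vs (avgr us H) s.
  have avg_lin ts K L x : avgr ts (fun t => a *: K t + L t) x =
      a *: avgr ts K x + avgr ts L x :> E.
    rewrite /avgr big_split /= -scaler_sumr scalerDr !scalerA.
    by congr (_ *: _ + _); rewrite mulrC.
  rewrite -avg_lin; congr (avgr _ _ _); apply/funext => t; exact: avg_lin.
rewrite opprD addrACA -scalerBr (le_trans (ler_normD _ _)) //.
have -> : e = `|a| * e' + e' by rewrite -[X in _ + X]mul1r -mulrDl mulrC divfK ?gt_eqF.
by rewrite normrZ lerD // ler_wpM2l // avgr_near.
Qed.

(** The default [0] is never reached for translation totally bounded functions, by [mean_exists]. *)
Definition mean F : E := xget 0 [set c | rmean F c /\ lmean F c].

Lemma mean_rmean F : translation_tb F -> rmean F (mean F).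
Proof.
move=> tb; rewrite /mean; case: xgetP => [c _ []//|h].
by have [c Fc F'c] := mean_exists tb; case: (h c).
Qed.

Lemma meanE F c : translation_tb F -> rmean F c -> mean F = c.
Proof.
move=> tb Fc; rewrite /mean; case: xgetP => [d _ [_ Fd]|h].
  exact/esym/(mean_unique Fc Fd).
by have [d Fd F'd] := mean_exists tb; case: (h d).
Qed.

Lemma mean_linear F H (a : R) : translation_tb F -> translation_tb H ->
  translation_tb (fun t => a *: F t + H t) ->
  mean (fun t => a *: F t + H t) = a *: mean F + mean H.
Proof.
move=> tbF tbH tb; apply: meanE => //; apply: rmean_linear => //;
  [exact: mean_rmean | exact: mean_rmean |].
have [c Hc H'c] := mean_exists tbH; by rewrite (meanE tbH Hc).
Qed.

End InvariantMeanExistence.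

(** * Compact representations *)

Section StrongTopology.
Local Open Scope ring_scope.
Context {R : realType} {E : banachLatticeType R}.
Implicit Types (x y z : E) (S T m : latticeAut E).

Lemma laut_eval_continuous x : continuous (fun T : latticeAut E => T x : E).
Proof.
move=> T.
have ev : continuous (fun f : {ptws E -> E} => f x).
  exact: (@proj_continuous _ (fun=> E) x).
have la : continuous (@laut_fun R E : latticeAut E -> {ptws E -> E}).
  exact: initial_continuous.
exact: (continuous_comp (la T) (ev _)).
Qed.

Lemma continuous_laut (X : topologicalType) (f : X -> latticeAut E) :
  (forall x, continuous (fun a => f a x : E)) -> continuous f.
Proof.
move=> fx; apply: continuous_comp_initial => a; apply/pointwise_cvgP => x.
exact: fx.
Qed.

Lemma laut_continuous T : continuous (T : E -> E).
Proof.
have [C C0 TC] := laut_bounded T.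
move=> x; apply/cvgrPdist_lt => e e0; near=> y.
rewrite -linearB; apply: le_lt_trans (TC _) _.
rewrite mulrC -ltr_pdivlMr //; near: y.
have /cvgrPdist_lt : y @[y --> x] --> x by exact: cvg_id.
by apply; rewrite divr_gt0.
Unshelve. all: by end_near. Qed.

Lemma laut_conj_continuous m :
  continuous (fun T : latticeAut E => (m * T * m^-1)%g).
Proof.
apply: continuous_laut => x T.
apply: (@continuous_comp _ _ _ (fun T : latticeAut E => T ((m^-1)%g x)) m).
  exact: laut_eval_continuous.
exact: laut_continuous.
Qed.

End StrongTopology.

(** * Total boundedness of the orbits of the central factors *)

Section CompactRepresentation.
Local Open Scope ring_scope.
Context {R : realType} {E : banachLatticeType R}.
Implicit Types (x y z w : E) (xs ys ws : seq E).

Lemma filter_forall_seq (X : Type) (F : set_system X) (xs : seq E)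
    (P : E -> X -> Prop) :
  Filter F -> (forall x, \forall a \near F, P x a) ->
  \forall a \near F, forall x, x \in xs -> P x a.
Proof.
move=> FF FP; elim: xs => [|x xs IH]; first exact: filterE.
apply: filterS2 (FP x) IH => a Pa IHa y.
by rewrite inE => /predU1P[->|/IHa].
Qed.

(** Total boundedness of the pairs [(phi u, rho u)] for the strong operator topology, with one
    finite set of group elements for both components. *)
Definition simultaneous_net (G : groupType) (rho phi : G -> latticeAut E) :=
  forall ys ws (e : R), 0 < e -> exists us : seq G, forall u, exists2 u', u' \in us &
    (forall y, y \in ys -> `|phi u y - phi u' y| <= e) /\
    (forall w, w \in ws -> `|rho u w - rho u' w| <= e).

Lemma compact_simultaneous_net (G : groupType) (rho : G -> latticeAut E)
    (q : latticeAut E -> latticeAut E) :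
  compact (range rho) -> {within range rho, continuous q} ->
  simultaneous_net rho (q \o rho).
Proof.
move=> /compact_near_coveringP cov /subspace_continuousP qc ys ws e e0.
(* The filter of properties shared by all sufficiently large finite sets; near [rho u], every finite
   set that contains [u] works. *)
pose F : set_system (seq G) :=
  [set P | exists us0 : seq G, forall us : seq G, {subset us0 <= us} -> P us].
have FF : Filter F.
  split.
  - by exists [::].
  - move=> P Q [us usP] [vs vsQ]; exists (us ++ vs) => ts sub.
    by split; [apply: usP|apply: vsQ] => u uu; apply: sub; rewrite mem_cat uu ?orbT.
  - by move=> P Q PQ [us usP]; exists us => ts /usP /PQ.
pose close (T T' : latticeAut E) :=
  (forall y, y \in ys -> `|q T y - q T' y| <= e) /\
  (forall w, w \in ws -> `|T w - T' w| <= e).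
pose P (us : seq G) T := range rho T -> exists2 u', u' \in us & close T (rho u').
suff P_near T : range rho T -> \near T & F, P F T.
  have [us0 /(_ us0 (fun=> id)) us0P] := cov _ F P FF P_near.
  exists us0 => u; have [||u' u'us cl] := us0P (rho u); [by exists u..|].
  by exists u'.
move=> [u _ <-] {T}.
have near_close : \forall T \near rho u, range rho T -> close T (rho u).
  have h1 : \forall T \near within (range rho) (nbhs (rho u)),
      forall y, y \in ys -> `|q T y - q (rho u) y| <= e.
    apply: filter_forall_seq => y.
    have /cvgrPdist_le/(_ e e0) :
        (q T y @[T --> within (range rho) (nbhs (rho u))]) --> q (rho u) y.
      have qu : q T @[T --> within (range rho) (nbhs (rho u))] --> q (rho u).
        by apply: qc; exists u.
      exact: (cvg_comp _ _ qu (@laut_eval_continuous R E y (q (rho u)))).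
    by apply: filterS => T; rewrite distrC.
  have h2 : \forall T \near nbhs (rho u),
      forall w, w \in ws -> `|(T : latticeAut E) w - rho u w| <= e.
    apply: filter_forall_seq => w.
    have /cvgrPdist_le/(_ e e0) := @laut_eval_continuous R E w (rho u).
    by apply: filterS => T; rewrite distrC.
  have {}h1 : \forall T \near rho u, range rho T ->
      forall y, y \in ys -> `|q T y - q (rho u) y| <= e := h1.
  by apply: filterS2 h1 h2 => T Th1 Th2 rT; split=> //; exact: Th1.
exists ([set T | range rho T -> close T (rho u)], [set us : seq G | u \in us]).
  by split=> //=; exists [:: u] => us; apply; rewrite mem_head.
by move=> [T us] [/= cl uus] rT; exists u => //; exact: cl.
Qed.

Section TranslationBounded.
Context {G : groupType} (rho phi : G -> latticeAut E).
Hypotheses (rhoM : positive_rep rho) (phiM : positive_rep phi).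
Hypothesis phi_isom : forall s, IAut E (phi s).
Hypothesis net : simultaneous_net rho phi.

Lemma positive_rep1 (r : G -> latticeAut E) : positive_rep r -> r 1%g = 1%g.
Proof.
move=> rM; have := rM 1%g 1%g; rewrite mulg1.
move=> /(congr1 (fun T : latticeAut E => T * (r 1)^-1)%g).
by rewrite -mulgA mulgV mulg1.
Qed.

Lemma positive_repV (r : G -> latticeAut E) s : positive_rep r -> r s^-1%g = (r s)^-1%g.
Proof.
move=> rM; have : (r s^-1 * r s = 1)%g by rewrite -rM mulVg positive_rep1.
by move=> /(congr1 (fun T : latticeAut E => T * (r s)^-1)%g); rewrite mulgK mul1g.
Qed.

Let rhoE s t x : rho (s * t)%g x = rho s (rho t x). Proof. by rewrite rhoM. Qed.
Let phiE s t x : phi (s * t)%g x = phi s (phi t x). Proof. by rewrite phiM. Qed.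
Let phiV s : phi s^-1%g = (phi s)^-1%g. Proof. exact: positive_repV. Qed.

(** A finite net of precision [1] bounds each orbit, and Banach-Steinhaus on the unit ball gives
    [B]. *)
Lemma rho_uniformly_bounded :
  exists2 B : R, 0 <= B & forall s x, `|rho s x| <= B * `|x|.
Proof.
pose F : set (E -> E) := [set (laut_fun (rho s)) | s in setT].
have F_lin f : F f -> bounded_fun_norm f /\ linear f.
  move=> [s _ <-]; split; last exact: linearP.
  have [C C0 TC] := laut_bounded (rho s).
  move=> r; exists (C * r) => x xr; apply: le_trans (TC x) _.
  by rewrite ler_pM2l.
have F_pt : pointwise_bounded F.
  move=> x; have [us usP] := net [::] [:: x] ltr01.
  exists (1 + \sum_(u <- us) `|rho u x|) => _ [s _ <-].
  have [u uus [_ /(_ x (mem_head _ _)) h]] := usP s.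
  rewrite -[rho s x](subrK (rho u x)) (le_trans (ler_normD _ _)) // lerD //.
  by rewrite (big_rem u uus) /= lerDl sumr_ge0.
have [M MP] := Banach_Steinhauss F_lin F_pt 1.
have M0 : 0 <= M.
  apply: le_trans (MP _ _ 0 _); [exact: normr_ge0 | by exists 1%g | by rewrite normr0].
exists M => // s x; have [->|x0] := eqVneq x 0.
  by rewrite linear0 !normr0 mulr0.
have nx : 0 < `|x| by rewrite normr_gt0.
have := MP _ (ex_intro2 _ _ s I erefl) (`|x|^-1 *: x).
rewrite normrZ ger0_norm ?invr_ge0 // mulVf ?gt_eqF // => /(_ (lexx _)).
rewrite linearZ /= normrZ ger0_norm ?invr_ge0 //.
by rewrite mulrC ler_pdivrMr.
Qed.

(** The orbit map of the central factors [m_t = rho_t phi_t^-1], with the inverse taken in [G]. *)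
Definition central_orbit x (t : G) : E := rho t (phi t^-1%g x).

Section Bound.
Variable B : R.
Hypotheses (B0 : 0 <= B) (rhoB : forall s x, `|rho s x| <= B * `|x|).

Lemma orbit_net x (e : R) : 0 < e ->
  exists ys, forall s, exists2 y, y \in ys & `|phi s x - y| <= e.
Proof.
move=> e0; have [us usP] := net [:: x] [::] e0.
exists [seq phi u x | u <- us] => s; have [u uus [h _]] := usP s.
by exists (phi u x); [exact: map_f | apply: h; rewrite mem_head].
Qed.

Lemma mixed_orbit_net x (e : R) : 0 < e ->
  exists ws, forall t s, exists2 w, w \in ws & `|rho t (phi s x) - w| <= e.
Proof.
(* Two successive nets of precision [d], the error of the first enlarged by [rho], add up to
   [B d + d = e]. *)
move=> e0; pose d := e / (B + 1).
have B1 : 0 < B + 1 by rewrite ltr_wpDl.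
have d0 : 0 < d by rewrite divr_gt0.
have [ys ysP] := orbit_net x d0.
have [us usP] := net [::] ys d0.
exists [seq rho u y | u <- us, y <- ys] => t s.
have [y yys xy] := ysP s; have [u uus [_ /(_ y yys) tu]] := usP t.
exists (rho u y); first exact: allpairs_f.
rewrite -(subrKA (rho t y)) (le_trans (ler_normD _ _)) //.
have -> : e = B * d + d by rewrite -[X in _ + X]mul1r -mulrDl mulrC divfK ?gt_eqF.
rewrite lerD // -linearB (le_trans (rhoB _ _)) //.
by rewrite ler_wpM2l.
Qed.

(** The value at [s v t] is [rho_s rho_v (a v)], where [a v] lies in a mixed orbit. Replacing [u] by
    [u'] changes [rho_v] and [a v] little, uniformly in [s] and [t], because the nets cover whole
    orbits. *)
Lemma central_orbit_tb x : translation_tb (central_orbit x).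
Proof.
(* The outer [B] is for [rho_s]; inside, [3 B B] accounts for the change of [a v] and [2 B + 1] for
   that of [rho_v]. *)
move=> eta eta0; pose K := B * (B * B * 3 + (B * 2 + 1)).
have K0 : 0 <= K by rewrite mulr_ge0 // !addr_ge0 ?mulr_ge0.
pose e := eta / (K + 1); have K1 : 0 < K + 1 by rewrite ltr_wpDl.
have e0 : 0 < e by rewrite divr_gt0.
have Ke : K * e <= eta.
  by rewrite /e mulrCA -[leRHS]mulr1 ler_pM2l // ler_pdivrMr // mul1r lerDl.
have [ys ysP] := orbit_net x e0; have [ws wsP] := mixed_orbit_net x e0.
have [us usP] := net ys ws e0.
exists us => u; have [u' u'us [uuy uuw]] := usP u; exists u' => // s t.
have phi_close r : `|phi u (phi r x) - phi u' (phi r x)| <= e *+ 3.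
  have [y yys ry] := ysP r.
  rewrite -(subrKA (phi u y)) -linearB mulrS (le_trans (ler_normD _ _)) //.
  rewrite lerD ?phi_isom // -(subrKA (phi u' y)) mulrS (le_trans (ler_normD _ _)) //.
  by rewrite lerD ?uuy // -linearB phi_isom distrC.
have rho_close r : `|rho u (rho t (phi r x)) - rho u' (rho t (phi r x))|
    <= (B * 2 + 1) * e.
  have [w wws rw] := wsP t r; set a := rho t _ in rw *.
  rewrite -(subrKA (rho u w)) -linearB (le_trans (ler_normD _ _)) //.
  have -> : (B * 2 + 1) * e = B * e + (e + B * e) by ring.
  apply: lerD; first by rewrite (le_trans (rhoB _ _)) // ler_wpM2l.
  rewrite -(subrKA (rho u' w)) -linearB (le_trans (ler_normD _ _)) //.
  by rewrite lerD ?uuw // (le_trans (rhoB _ _)) // ler_wpM2l // distrC.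
pose a v := rho t (phi (t^-1 * (v^-1 * s^-1))%g x).
have FE v : central_orbit x (s * v * t)%g = rho s (rho v (a v)).
  by rewrite /central_orbit /a -!rhoE !invgM mulgA.
(* Applying the isometry [phi u] turns the difference of [u^-1] and [u'^-1] into one of [phi u'] and
   [phi u] at a single orbit point. *)
have aa : `|a u - a u'| <= B * (e *+ 3).
  rewrite /a -linearB (le_trans (rhoB _ _)) // ler_wpM2l //.
  rewrite !(phiE t^-1) -linearB phi_isom -(phi_isom u) linearB /= -!phiE.
  rewrite mulgA mulgV mul1g.
  have := phi_close (u'^-1 * s^-1)%g; rewrite -!phiE (mulgA u') mulgV mul1g.
  by rewrite distrC.
rewrite !FE -linearB; apply: le_trans Ke; apply: le_trans (rhoB _ _) _.
rewrite /K -[leRHS]mulrA ler_wpM2l // -(subrKA (rho u' (a u))).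
apply: le_trans (ler_normD _ _) _; rewrite addrC mulrDl lerD //.
  rewrite -linearB (le_trans (rhoB _ _)) // -!mulrA ler_wpM2l //.
  by rewrite mulr_natl.
exact: rho_close.
Qed.

End Bound.
End TranslationBounded.
End CompactRepresentation.

(** * Operators between two positive multiples of the identity *)

Section CentralBijection.
Local Open Scope ring_scope.
Context {R : realType} {E : banachLatticeType R}.
Implicit Types (x y z : E).

Lemma vpos_subr x y : vdisj x y -> vpos (x - y) = x.
Proof. by move=> xy; rewrite vpos_meet xy subr0. Qed.

Lemma vjoin_pos x y : vjoin x y = vpos (x - y) + y.
Proof. by rewrite /vpos -vjoinDr subrK add0r. Qed.

Variables (M : {linear E -> E}) (b C : R).
Hypotheses (b0 : 0 < b) (bC : b <= C).
Hypothesis bM : forall x, 0 <=| x -> b *: x <=| M x.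
Hypothesis MC : forall x, 0 <=| x -> M x <=| C *: x.

Let C0 : 0 < C. Proof. exact: lt_le_trans bC. Qed.

Let M_ge0 x : 0 <=| x -> 0 <=| M x.
Proof. by move=> x0; apply: vletr (bM x0); rewrite vscale_ge0 ?ltW. Qed.

(** [M x^+] and [M x^-] lie below multiples of disjoint elements, so they are the positive and
    negative parts of [M x]. *)
Lemma central_vpos x : M (vpos x) = vpos (M x).
Proof.
rewrite -{2}[x]vposB linearB /= vpos_subr //.
apply: (@vdisj_le _ _ _ (C *: vpos x) _ (C *: vpos (- x))).
- exact/M_ge0/vpos_ge0.
- exact/M_ge0/vpos_ge0.
- exact/MC/vpos_ge0.
- exact/MC/vpos_ge0.
- by apply: vdisjZ; rewrite ?ltW ?vpos_ge0 //; exact: vpos_disj.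
Qed.

Lemma central_vjoin : {morph M : x y / vjoin x y}.
Proof. by move=> x y; rewrite !vjoin_pos linearD /= central_vpos linearB. Qed.

Lemma central_vmeet : {morph M : x y / vmeet x y}.
Proof. by move=> x y; rewrite !vmeetE linearN /= central_vjoin !linearN. Qed.

(** On the cone [0 <= S <= q I] with [q = 1 - b / C < 1], so [S] is a strict contraction. *)
Let S : {linear E -> E} := idfun \- (C^-1 \*: M).
Let q : R := 1 - b / C.

Let q0 : 0 <= q. Proof. by rewrite subr_ge0 ler_pdivrMr ?mul1r. Qed.

Let q1 : q < 1. Proof. by rewrite gtrBl divr_gt0. Qed.

Let S_bound : order_bounded_by q S.
Proof.
move=> x x0; have CV0 : 0 <= C^-1 by rewrite invr_ge0 ltW.
rewrite vabs_id /=.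
  rewrite /q scalerBl scale1r; apply: vleD; first exact: vlexx.
  by rewrite vleN2 mulrC -scalerA; apply: vleZ2l => //; exact: bM.
rewrite subv_ge0; have := vleZ2l CV0 (MC x0).
by rewrite scalerA mulVf ?gt_eqF // scale1r.
Qed.

Lemma central_inj : injective M.
Proof.
move=> x y Mxy; apply/eqP; rewrite -subr_eq0 -normr_le0.
have := order_bounded_norm q0 S_bound (x - y).
rewrite /= linearB /= Mxy subrr scaler0 subr0 -subr_le0 -{1}[`|_|]mul1r -mulrBl.
by rewrite pmulr_rle0 // subr_gt0.
Qed.

(** Solutions of [M x = y] are the fixed points of [x - C^-1 (M x - y)], a map with linear part
    [S]. *)
Lemma central_surj y : exists x, M x = y.
Proof.
have shift_dist (u v w t k : E) : u - (v - k) - (w - (t - k)) = u - w - (v - t).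
  by rewrite [- (w - _)]opprD addrACA -opprD [- (t - k)]opprB subrKA.
have ctr : is_contraction ('totalfun_[set: E] (fun x => x - C^-1 *: (M x - y))).
  exists (NngNum q0); split=> //= -[x z] _ /=; rewrite /totalfun_.
  apply: le_trans (order_bounded_norm q0 S_bound (x - z)).
  by rewrite /= [M (x - z)]linearB /= !scalerBr shift_dist.
have [|x _] := banach_fixed_point ctr closedT; first by exists 0.
rewrite /totalfun_ => /esym/eqP; rewrite -subr_eq0 addrAC subrr sub0r oppr_eq0.
rewrite scaler_eq0 invr_eq0 gt_eqF //= subr_eq0 => /eqP; by exists x.
Qed.

Lemma central_automorphism : exists2 m : latticeAut E, ZAut E m & m =1 M.
Proof.
have [N MN] := choice central_surj.
have NM : cancel M N by move=> x; apply: central_inj; rewrite MN.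
pose m : latticeAut E := LatticeAut (linearP M) central_vmeet central_vjoin NM MN.
exists m => //; apply/ZAutP; exists C; [exact: ltW | exact: MC].
Qed.

End CentralBijection.

(** * Averaging the central factors *)

Section Averaging.
Local Open Scope ring_scope.
Context {R : realType} {E : banachLatticeType R} {G : groupType}.
Implicit Types (x y z : E) (F : G -> E).

Lemma avgr_ge0 (us : seq G) F s :
  (forall t, 0 <=| F t) -> 0 <=| avgr us F s.
Proof.
move=> F0; apply: vscale_ge0; first by rewrite invr_ge0.
by elim/big_ind: _ => //; [exact: vlexx | exact: vaddr_ge0].
Qed.

Lemma rmean_ge F c y : rmean F c -> (forall t, y <=| F t) -> y <=| c.
Proof.
move=> Fc yF; rewrite -subv_ge0; apply: vge0_closed => e /Fc[us [us0 usc]].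
exists (avgr us (fun t => F t - y) 1%g).
  by apply: avgr_ge0 => t; rewrite subv_ge0.
have -> : avgr us (fun t => F t - y) 1%g = avgr us F 1%g - y.
  by rewrite /avgr sumrB scalerBr avg_cst.
by rewrite opprB addrA subrK distrC usc.
Qed.

Lemma rmean_le F c y : rmean F c -> (forall t, F t <=| y) -> c <=| y.
Proof.
move=> Fc Fy; rewrite -vleN2; apply: (@rmean_ge (fun t => - F t)) => [e|t].
  move=> /Fc[us [us0 usc]]; exists us; split=> // s.
  have -> : avgr us (fun t => - F t) s = - avgr us F s.
    by rewrite /avgr sumrN scalerN.
  by rewrite -opprD normrN.
by rewrite vleN2.
Qed.

Variables (rho phi : G -> latticeAut E).
Hypotheses (rhoM : positive_rep rho) (phiM : positive_rep phi).
Hypothesis phi_isom : forall s, IAut E (phi s).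
Hypothesis net : simultaneous_net rho phi.
Hypothesis central : forall s, ZAut E (rho s * (phi s)^-1)%g.

(* The average [M] of the central factors [m_t = rho_t phi_t^-1]; translation
   invariance of the mean and [m_(st) phi_s = rho_s m_t] give [M phi_s = rho_s M]. *)
Lemma averaged_intertwiner :
  exists2 m, ZAut E m & forall s, rho s = (m * phi s * m^-1)%g.
Proof.
have [B B0 rhoB] := rho_uniformly_bounded net.
have tb x : translation_tb (central_orbit rho phi x).
  by move=> eta; exact: (central_orbit_tb rhoM phiM phi_isom net B0 rhoB).
pose M x := mean (central_orbit rho phi x).
have M_lin : linear M.
  move=> a x y; rewrite /M -mean_linear //; last first.
    have -> : (fun t => a *: central_orbit rho phi x t + central_orbit rho phi y t) =
      central_orbit rho phi (a *: x + y); last exact: tb.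
    by apply/funext => t; rewrite /central_orbit !linearP.
  by congr mean; apply/funext => t; rewrite /central_orbit !linearP.
have orbitE x t : central_orbit rho phi x t = (rho t * (phi t)^-1)%g x.
  by rewrite /central_orbit positive_repV.
have orbit_le t x : `|(rho t * (phi t)^-1)%g x| <= B * `|x|.
  by rewrite lautM (le_trans (rhoB _ _)) // -positive_repV // phi_isom.
(* The inverse of a central factor has the same bound, as [rho_t^-1] is the value of [rho] at
   [t^-1]. *)
have orbit_ge t x : `|x| <= B * `|(rho t * (phi t)^-1)%g x|.
  rewrite -{1}[x](lautVK (phi t)) phi_isom.
  rewrite -[X in `|X| <= _](lautKV (rho t)) -(positive_repV _ rhoM).
  exact: rhoB.
(* [B + 1] strictly exceeds [B], as [central_le] requires, and [B b < 1], as [central_ge]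
   requires. *)
pose b := (B + 1)^-1; have B1 : 0 < B + 1 by rewrite ltr_wpDl.
have b0 : 0 < b by rewrite invr_gt0.
have Bb : B * b < 1 by rewrite ltr_pdivrMr // mul1r ltrDl.
have bB : b <= B + 1.
  by rewrite (@le_trans _ _ 1) // ?invf_le1 // lerDr.
have bM x : 0 <=| x -> b *: x <=| M x.
  move=> x0; apply: rmean_ge (mean_rmean (tb x)) _ => t; rewrite orbitE.
  exact: central_ge (central t) B0 (ltW b0) Bb (orbit_ge t) _ x0.
have MB x : 0 <=| x -> M x <=| (B + 1) *: x.
  move=> x0; apply: rmean_le (mean_rmean (tb x)) _ => t; rewrite orbitE.
  by apply: central_le (central t) B0 _ (orbit_le t) _ x0; rewrite ltrDl.
pose ML : {linear E -> E} := HB.pack M (GRing.isLinear.Build R E E *:%R M M_lin).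
have [m mZ mM] := @central_automorphism R E ML b (B + 1) b0 bB bM MB.
exists m => // s; suff : (rho s * m = m * phi s)%g by move=> <-; rewrite mulgK.
apply: laut_eqP => x; rewrite !lautM !mM /= /M; apply/esym; apply: meanE => // e e0.
pose d := e / (B + 1); have d0 : 0 < d by rewrite divr_gt0.
have [us [us0 usM]] := mean_rmean (tb x) d0.
exists us; split=> // r.
(* The cocycle identity, as [m_r phi_s = rho_s m_(s^-1 r)]; the shift of the base point is harmless
   because means are uniform in it. *)
have -> : avgr us (central_orbit rho phi (phi s x)) r =
    rho s (avgr us (central_orbit rho phi x) (s^-1 * r)%g).
  rewrite /avgr [RHS]linearZ [X in _ = _ *: X]linear_sum.
  congr (_ *: _); apply: eq_bigr => u _.
  rewrite /= /central_orbit -[rho s (rho _ _)]lautM -rhoM -[phi _ (phi s x)]lautM -phiM.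
  by rewrite !mulgA mulgV mul1g !invgM invgK !mulgA.
rewrite -linearB; apply: le_trans (rhoB _ _) _.
apply: le_trans (ler_wpM2l B0 (usM _)) _.
by rewrite /d mulrCA ler_piMr ?ltW // ltr_pdivrMr // mul1r ltrDl.
Qed.

End Averaging.

(** * The isometric part as a homomorphism, and conjugation *)

Section IsometricRepresentation.
Context {R : realType} {E : banachLatticeType R}.
Local Open Scope group_scope.

Lemma ZIAut_isom_part (T : latticeAut E) : ZIAut E T ->
  IAut E (isom_part T) /\ ZAut E (T * (isom_part T)^-1).
Proof. by move=> [m mZ [phi phiI <-]]; rewrite isom_partE // mulgK. Qed.

(** Moving [phi] past [n] replaces [n] by its conjugate [phi n phi^-1], which is central. *)
Lemma isom_partM (S T : latticeAut E) : ZIAut E S -> ZIAut E T ->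
  isom_part (S * T) = isom_part S * isom_part T.
Proof.
move=> [m mZ [phi phiI <-]] [n nZ [psi psiI <-]].
have -> : m * phi * (n * psi) = m * (phi * n * phi^-1) * (phi * psi).
  by rewrite !mulgA mulgVK.
rewrite !isom_partE //; last exact: IAutM.
by apply: ZAutM => //; exact: ZAutJ.
Qed.

Lemma range_group_closed (G : groupType) (rho : G -> latticeAut E) :
  positive_rep rho -> group_closed [in range rho].
Proof.
move=> rhoM; split.
  by rewrite inE; exists 1 => //; exact: positive_rep1.
move=> _ _ /set_mem[s _ <-] /set_mem[t _ <-]; rewrite inE; exists (s / t) => //.
by rewrite rhoM positive_repV.
Qed.

Lemma compact_range_conj (G : Type) (rho pi : G -> latticeAut E) (m : latticeAut E) :
  (forall s, rho s = m * pi s * m^-1) -> compact (range pi) -> compact (range rho).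
Proof.
move=> rhoE; have -> : range rho = (fun T => m * T * m^-1) @` range pi.
  rewrite image_comp; apply: eq_imagel => s _; exact: rhoE.
by apply: continuous_compact; apply: continuous_subspaceT; exact: laut_conj_continuous.
Qed.

Lemma continuous_conj (X : topologicalType) (rho pi : X -> latticeAut E)
    (m : latticeAut E) :
  (forall s, rho s = m * pi s * m^-1) -> continuous pi -> continuous rho.
Proof.
move=> rhoE pic; have -> : rho = (fun T => m * T * m^-1) \o pi by apply/funext.
move=> s; apply: continuous_comp; [exact: pic | exact: laut_conj_continuous].
Qed.

(** Exchanges [rho] and [pi]; the form [m^-1^-1] fits the hypotheses of [compact_range_conj] and
    [continuous_conj], which thus serve both directions. *)
Lemma conjE (G : Type) (rho pi : G -> latticeAut E) (m : latticeAut E) :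
  (forall s, rho s = m * pi s * m^-1) -> forall s, pi s = m^-1 * rho s * m^-1^-1.
Proof. by move=> rhoE s; rewrite rhoE invgK !mulgA mulVg mul1g mulgVK. Qed.

End IsometricRepresentation.

(** * The correspondence between [rho] and [pi] *)

Local Open Scope group_scope.

Theorem theorem4p1 (R : realType) (E : banachLatticeType R)
    (hA : assumptionA E) :
  (forall G : groupType,
    (forall rho : G -> latticeAut E,
      positive_rep_in (ZIAut E) rho -> compact (range rho) ->
      (exists! pi : G -> latticeAut E, positive_rep_in (IAut E) pi /\
        exists2 m, ZAut E m & forall s, rho s = m * pi s * m^-1) /\
      (forall (pi : G -> latticeAut E) (m : latticeAut E),
        positive_rep_in (IAut E) pi -> ZAut E m ->
        (forall s, rho s = m * pi s * m^-1) ->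
        compact (range pi)))
    /\
    (forall (pi : G -> latticeAut E) (m : latticeAut E),
      positive_rep_in (IAut E) pi -> compact (range pi) -> ZAut E m ->
      let rho := fun s => m * pi s * m^-1 in
      positive_rep_in (ZIAut E) rho /\ compact (range rho)))
  /\
  (forall (G : topologicalGroupType) (rho pi : G -> latticeAut E)
      (m : latticeAut E),
    positive_rep_in (ZIAut E) rho -> compact (range rho) ->
    positive_rep_in (IAut E) pi -> ZAut E m ->
    (forall s, rho s = m * pi s * m^-1) ->
    (continuous rho <-> continuous pi)).
Proof.
split=> [G|G rho pi m _ _ _ _ rhoE]; last first.
  by split; apply: continuous_conj; [exact: conjE rhoE | exact: rhoE].
split=> [rho [rhoM rhoZI] rhoK|pi m [piM piI] piK mZ rho].
  split=> [|pi m _ _ rhoE]; last exact: compact_range_conj (conjE rhoE) rhoK.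
  have ZI s : ZIAut E (rho s) by apply: rhoZI; exists s.
  pose phi s := isom_part (rho s).
  have phiM : positive_rep phi by move=> s t; rewrite /phi rhoM isom_partM.
  have phiI s : IAut E (phi s) by have [] := ZIAut_isom_part (ZI s).
  have central s : ZAut E (rho s * (phi s)^-1) by have [] := ZIAut_isom_part (ZI s).
  (* Assumption (A) enters here: it makes the isometric part continuous on the compact group
     [rho(G)]. *)
  have net : simultaneous_net rho phi.
    apply: (compact_simultaneous_net rhoK).
    exact: hA (range_group_closed rhoM) rhoK rhoZI.
  have [m mZ rhoE] := averaged_intertwiner rhoM phiM phiI net central.
  exists phi; split=> [|psi [[psiM psiI] [n nZ rhoE']]].
    by split; [split=> // _ [s _ <-]; exact: phiI | exists m].
  (* Any competitor [psi] is the isometric part of its conjugate [rho], hence equals [phi]. *)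
  apply/funext => s; rewrite /phi rhoE'.
  by have [_ ->] := conj_ZIAut nZ (psiI _ (ex_intro2 _ _ s I erefl)).
have rhoE s : rho s = m * pi s * m^-1 by [].
split; last exact: compact_range_conj rhoE piK.
split=> [s t|_ [s _ <-]]; first by rewrite /rho piM !mulgA mulgVK.
by have [] := conj_ZIAut mZ (piI _ (ex_intro2 _ _ s I erefl)).
Qed.
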